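(* There exists a universal constant $C>0$ such that the following holds for all integers $n\ge4$ and all $\epsilon\in(0,\frac18]$. Let $x_\epsilon$ be the leader strategy in the Stackelberg game $G^{\frac{1}{2(n-1)},n}_{\mathsf{Stck}}$ with $x_\epsilon(1)=\frac12-\frac{\epsilon}{2}$ and with all other leader actions having equal probability. If $$k\;\ge\; C\left(\log n+\log\frac1\epsilon\right)\frac{n}{\epsilon^2},$$ then $IR_k(x_\epsilon)\ge\frac12-\epsilon$.
   Context: Stackelberg game $G^{\tau,n}_{\mathsf{Stck}}$ ($\tau\in[0,1/n]$): the leader's action set is $[n]=\{1,\dots,n\}$; a leader strategy is a distribution $x\in\Delta^{[n]}$. The follower's action set is $A_n=\{a_j\}_{j\in[n]}\cup\{a_{(j\ell)}:j\in[n],\ \ell\in[n]\setminus\{j\}\}$. Writing $u(:,a)\in\mathbb{R}^n$ for the vector of utilities $u(i,a)$, $i\in[n]$, the follower's utility is $u_F(:,a_j)=e_j$ and $u_F(:,a_{(j\ell)})=e_j+\tau\mathbf{1}-e_\ell$; the leader's utility is $u_L(:,a_j)=e_j$ and $u_L(:,a_{(j\ell)})=\mathbf{0}$. Here $e_j$ is the $j$-th standard basis vector, $\mathbf 1$ the all-ones vector and $\mathbf{0}$ the zero vector. Here $\tau=\frac1{2(n-1)}$. For $y\in\Delta^{[n]}$, $a(y)$ is an element of $\arg\max_{a\in A_n}\langle u_F(:,a),y\rangle$, ties broken in favor of an action maximizing $\langle u_L(:,a),y\rangle$ (remaining ties by a fixed selection). Inference setting: the leader commits to $x$, and at round $k$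 the follower has the empirical distribution $\hat x_k\in\Delta^{[n]}$ of $k$ i.i.d. samples from $x$ and plays $a(\hat x_k)$, while the leader's current action is drawn from $x$ independently. The leader's round-$k$ reward is $IR_k(x)=\mathbb{E}\big[\langle u_L(:,a(\hat x_k)),x\rangle\big]$. *)

(* Defs.v *)
From HB Require Import structures.
From mathcomp Require Import all_boot all_order all_algebra.
From mathcomp Require Import reals exp.
Set Implicit Arguments.
Unset Strict Implicit.
Unset Printing Implicit Defensive.
Import Order.TTheory GRing.Theory Num.Theory.
Local Open Scope ring_scope.

Section Stackelberg.
Variables (R : realType) (n : nat).

Definition dot (u v : 'rV[R]_n) : R := \sum_(i < n) u 0 i * v 0 i.

Definition is_dist (x : 'rV[R]_n) : Prop :=
  (forall i, 0 <= x 0 i) /\ \sum_(i < n) x 0 i = 1.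

(* [inl j] is a_j, and [inr (j, l)] (with j != l) is a_(jl). *)
Definition faction : finType :=
  ('I_n + {p : 'I_n * 'I_n | p.1 != p.2})%type.

Definition uF (tau : R) (a : faction) : 'rV[R]_n :=
  match a with
  | inl j => delta_mx 0 j
  | inr p => delta_mx 0 (val p).1 + tau *: const_mx 1 - delta_mx 0 (val p).2
  end.

Definition uL (a : faction) : 'rV[R]_n :=
  match a with
  | inl j => delta_mx 0 j
  | inr _ => 0
  end.

Definition best_response (tau : R) (y : 'rV[R]_n) (a : faction) : Prop :=
  forall b, dot (uF tau b) y <= dot (uF tau a) y.

(* Ties that remain after favouring the leader are resolved by the choice of
   the function [a] itself, so quantifying over all such [a] covers every
   fixed selection. *)
Definition response_rule (tau : R) (a : 'rV[R]_n -> faction) : Prop :=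
  forall y, is_dist y ->
    best_response tau y (a y) /\
    forall b, best_response tau y b -> dot (uL b) y <= dot (uL (a y)) y.

Definition empirical (k : nat) (s : {ffun 'I_k -> 'I_n}) : 'rV[R]_n :=
  \row_i (#|[set t | s t == i]|%:R / k%:R).

(* Expectation over k i.i.d. samples from [x]: a sample sequence [s] has
   probability \prod_t x (s t). *)
Definition IR (a : 'rV[R]_n -> faction) (k : nat) (x : 'rV[R]_n) : R :=
  \sum_(s : {ffun 'I_k -> 'I_n})
    (\prod_(t < k) x 0 (s t)) * dot (uL (a (empirical s))) x.

(* Leader action 1 is the ordinal of value 0. The probability of the other
   n - 1 actions is forced by equality and total mass 1 (see [x_eps_dist]). *)
Definition x_eps (eps : R) : 'rV[R]_n :=
  \row_i (if val i == 0%N then 1 / 2 - eps / 2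
          else (1 / 2 + eps / 2) / (n%:R - 1)).

End Stackelberg.

Lemma x_eps_dist (R : realType) (n : nat) (eps : R) :
  (2 <= n)%N -> 0 <= eps -> eps <= 1 -> is_dist (x_eps n eps).
Proof.
case: n => [|[|n]] // _ e0 e1; split.
  move=> i; rewrite mxE; case: ifP => _.
    by rewrite -mulrBl divr_ge0 ?subr_ge0.
  by rewrite -[n.+2%:R]natr1 addrK divr_ge0 ?addr_ge0 ?divr_ge0.
rewrite big_ord_recl mxE /=.
under eq_bigr => i _ do rewrite mxE /=.
rewrite sumr_const card_ord -[n.+2%:R]natr1 addrK -[X in _ + X]mulr_natr.
by rewrite divfK ?pnatr_eq0 // addrACA addNr addr0 -splitr.
Qed.

Lemma response_rule_exists (R : realType) (n : nat) (tau : R) :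
  (0 < n)%N -> exists a : 'rV[R]_n -> faction n, response_rule tau a.
Proof.
move=> n0; pose a0 : faction n := inl (Ordinal n0).
pose fm (y : 'rV[R]_n) := [arg max_(a > a0) dot (uF tau a) y]%O.
pose best (y : 'rV[R]_n) (a : faction n) :=
  [forall b, dot (uF tau b) y <= dot (uF tau a) y].
have bfm y : best y (fm y).
  by rewrite /fm; case: arg_maxP => // i _ Hi; apply/forallP => b; apply: Hi.
exists (fun y => [arg max_(a > fm y | best y a) dot (uL R a) y]%O) => y _.
case: arg_maxP => [|i Pi Hi]; first exact: bfm.
split; first by move=> b; move/forallP: Pi.
by move=> b Hb; apply: Hi; apply/forallP.
Qed.

(* Main.v *)
Require Import Defs.
From mathcomp Require Import all_boot all_order all_algebra.
From mathcomp Require Import ring lra.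
From mathcomp Require Import reals sequences exp.
Set Implicit Arguments.
Unset Strict Implicit.
Unset Printing Implicit Defensive.
Import Order.TTheory GRing.Theory Num.Theory.
Local Open Scope ring_scope.

(** Write [y] for the empirical distribution and [tau = 1 / (2 (n - 1))]. If
    [y_l >= tau] and [y_l < y_1] for every [l != 1], then the follower answers
    with [a_1], and the leader earns [x_1 = 1/2 - eps/2]; all other rewards are
    nonnegative. Since [x_l = tau (1 + eps)] for [l != 1], a Chernoff bound with
    parameter [eps / 2] gives [P(y_l < tau) <= exp (- k tau eps^2 / 5)], and a
    Chernoff bound with parameter [ln 2] gives [P(y_l >= y_1) <= exp (- k / 32)].
    By the union bound the good event fails with probability at most [eps] when
    [k] is large, and [(1 - eps) (1/2 - eps/2) >= 1/2 - eps]. *)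

(** * The follower's response to an empirical distribution *)

Section Response.
Variables (R : realType) (n : nat).
Implicit Types (u y : 'rV[R]_n) (tau : R).

Lemma sum_mul_indic (f : 'I_n -> R) (l : 'I_n) :
  \sum_i f i * (i == l)%:R = f l.
Proof.
rewrite (bigD1 l) //= eqxx mulr1 big1 ?addr0 // => i /negbTE ->.
by rewrite mulr0.
Qed.

Lemma dot_deltal (j : 'I_n) y : dot (delta_mx 0 j) y = y 0 j.
Proof.
rewrite /dot -[RHS](sum_mul_indic (fun i => y 0 i)).
by apply: eq_bigr => i _; rewrite mxE eqxx mulrC.
Qed.

Lemma dot0l y : dot 0 y = 0.
Proof. by rewrite /dot big1 // => i _; rewrite mxE mul0r. Qed.

Lemma dot_uL_ge0 (a : faction n) y :
  (forall i, 0 <= y 0 i) -> 0 <= dot (uL R a) y.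
Proof. by case: a => [j|p] y0 /=; rewrite ?dot_deltal ?dot0l. Qed.

Lemma dot_uF_inr tau y (p : {p : 'I_n * 'I_n | p.1 != p.2}) :
  \sum_i y 0 i = 1 ->
  dot (uF tau (inr p)) y = y 0 (val p).1 + tau - y 0 (val p).2.
Proof.
move=> y1; rewrite -(dot_deltal (val p).1 y) -(dot_deltal (val p).2 y).
rewrite -[tau in RHS]mulr1 -y1 mulr_sumr /dot -sumrN -!big_split /=.
by apply: eq_bigr => i _; rewrite !mxE; ring.
Qed.

(** Against a_(il), the claim y_i + tau - y_l <= y_j is the sum of y_i <= y_j and tau <= y_l. *)
Lemma best_response_inl tau y (j : 'I_n) : is_dist y ->
  (forall l, l != j -> tau <= y 0 l) -> (forall l, y 0 l <= y 0 j) ->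
  best_response tau y (inl j).
Proof.
move=> [_ y1] ytau ymax [i|p].
  by rewrite /= !dot_deltal.
rewrite dot_uF_inr //= dot_deltal.
have tau_le : tau <= y 0 (val p).2.
  have [p2j|/ytau//] := eqVneq (val p).2 j.
  (* [ytau] does not cover [j] itself, but here [(val p).1] differs from [j], so tau is at most its
     mass, hence at most [y 0 j]. *)
  rewrite p2j; apply: le_trans (ymax (val p).1); apply: ytau.
  by rewrite -p2j; exact: (valP p).
have := ymax (val p).1; lra.
Qed.

(** Since a_j is a best response, tie-breaking gives the leader at least y_j at [a y]. Another a_i
    yields only y_i < y_j, and a_(il) yields 0, which would force every y_i <= 0 against total mass
    1. *)
Lemma response_inl tau (a : 'rV[R]_n -> faction n) y (j : 'I_n) :
  response_rule tau a -> is_dist y ->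
  (forall l, l != j -> tau <= y 0 l) ->
  (forall l, l != j -> y 0 l < y 0 j) ->
  a y = inl j.
Proof.
move=> ruleP ydist ytau ylt.
have ymax l : y 0 l <= y 0 j by have [->//|/ylt/ltW] := eqVneq l j.
have [_ /(_ _ (best_response_inl ydist ytau ymax))] := ruleP y ydist.
case: (a y) => [i|p] /=; rewrite !dot_deltal ?dot0l => yj.
  by have [->//|/ylt] := eqVneq i j; rewrite ltNge yj.
have : \sum_i y 0 i <= 0.
  by apply: sumr_le0 => i _; apply: le_trans yj.
by rewrite (proj2 ydist) ler10.
Qed.

End Response.

(** * Sampling and tail bounds *)

Section Sampling.
Variables (R : realType) (n k : nat).
Implicit Types (x : 'rV[R]_n) (s : {ffun 'I_k -> 'I_n}) (f : 'I_n -> R).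
Implicit Type P : pred {ffun 'I_k -> 'I_n}.

(** Uses the same weights as [IR], so that probabilities and rewards compare sample by sample. *)
Definition sample_pr x P : R := \sum_(s | P s) \prod_(t < k) x 0 (s t).

Lemma empirical_mean s f :
  k%:R * (\sum_i empirical R s 0 i * f i) = \sum_(t < k) f (s t).
Proof.
rewrite (eq_bigr (fun t => \sum_i f i * (i == s t)%:R)); last first.
  by move=> t _; rewrite sum_mul_indic.
rewrite exchange_big mulr_sumr /=; apply: eq_bigr => i _.
rewrite -mulr_sumr mxE mulrA mulrC; congr (_ * _).
have -> : \sum_(t < k) (i == s t)%:R = #|[set t | s t == i]|%:R :> R.
  rewrite -natr_sum -sum1_card [in RHS]big_mkcond /=; congr (_%:R).
  by apply: eq_bigr => t _; rewrite inE eq_sym; case: eqP.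
case: (posnP k) s => [k0 s|k0 s]; last by rewrite mulrC divfK // pnatr_eq0 -lt0n.
rewrite [#|_|](_ : _ = 0%N) ?mul0r ?mulr0 //.
by apply/eqP; rewrite -leqn0 -k0 -[leqRHS](card_ord k) max_card.
Qed.

Lemma empirical_dist s : (0 < k)%N -> is_dist (empirical R s).
Proof.
move=> k0; split=> [i|]; first by rewrite mxE divr_ge0.
have kn0 : k%:R != 0 :> R by rewrite pnatr_eq0 -lt0n.
apply: (mulfI kn0); have := empirical_mean s (fun=> 1).
by rewrite sumr_const card_ord mulr1; under eq_bigr do rewrite mulr1.
Qed.

Lemma sample_pr_predT x : \sum_i x 0 i = 1 -> sample_pr x predT = 1.
Proof.
move=> x1; rewrite /sample_pr -(bigA_distr_bigA (fun _ i => x 0 i)) /=.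
by rewrite prodr_const x1 expr1n.
Qed.

Lemma sample_pr_predC x P :
  \sum_i x 0 i = 1 -> sample_pr x (predC P) = 1 - sample_pr x P.
Proof.
move=> x1; rewrite -(sample_pr_predT x1) /sample_pr [in RHS](bigID P) /=.
by rewrite addrC addrK.
Qed.

Lemma sample_pr_exists x (I : finType) (Q : I -> pred {ffun 'I_k -> 'I_n}) :
  (forall i, 0 <= x 0 i) ->
  sample_pr x (fun s => [exists i, Q i s]) <= \sum_i sample_pr x (Q i).
Proof.
move=> x0; rewrite /sample_pr.
under [leRHS]eq_bigr do rewrite big_mkcond.
rewrite exchange_big /= big_mkcond /=; apply: ler_sum => s _.
have F0 : 0 <= \prod_(t < k) x 0 (s t) by apply: prodr_ge0.
case: existsP => [[i Qi]|_]; last by apply: sumr_ge0 => i _; case: ifP.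
by rewrite (bigD1 i) //= Qi lerDl sumr_ge0 // => j _; case: ifP.
Qed.

Lemma sample_pr_or x P Q : (forall i, 0 <= x 0 i) ->
  sample_pr x (fun s => P s || Q s) <= sample_pr x P + sample_pr x Q.
Proof.
move=> x0; rewrite /sample_pr !(big_mkcond P) !(big_mkcond Q) -big_split /=.
rewrite big_mkcond /=; apply: ler_sum => s _.
have F0 : 0 <= \prod_(t < k) x 0 (s t) by apply: prodr_ge0.
by case: (P s); case: (Q s); rewrite /= ?addr0 ?add0r // lerDl.
Qed.

(** On [P] the exponential of the sum of f over the samples is at least 1, and its expectation
    factors by independence. The Chernoff parameter is absorbed into [f]. *)
Lemma chernoff x f P : (forall i, 0 <= x 0 i) ->
  (forall s, P s -> 0 <= \sum_i empirical R s 0 i * f i) ->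
  sample_pr x P <= (\sum_i x 0 i * expR (f i)) ^+ k.
Proof.
move=> x0 Pf.
rewrite -[X in _ ^+ X](card_ord k) -prodr_const.
rewrite (bigA_distr_bigA (fun _ i => x 0 i * expR (f i))) /=.
rewrite /sample_pr big_mkcond /=; apply: ler_sum => s _.
have F0 : 0 <= \prod_(t < k) x 0 (s t) by apply: prodr_ge0.
rewrite big_split /= -expR_sum -empirical_mean.
case: ifP => [/Pf fs|_]; last by rewrite mulr_ge0 ?expR_ge0.
rewrite ler_peMr //; apply: le_trans (expR_ge1Dx _).
by rewrite lerDl mulr_ge0.
Qed.

Lemma empirical_lower_tail x (l : 'I_n) (tau eps : R) :
  (0 < k)%N -> is_dist x ->
  0 < tau -> 0 < eps -> eps <= 1 / 8 -> x 0 l = tau * (1 + eps) ->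
  sample_pr x (fun s => empirical R s 0 l < tau)
    <= expR (- (tau * eps ^+ 2 / 5)) ^+ k.
Proof.
move=> k0 [x0 x1] tau0 eps0 eps8 xl.
(* Once exp (- lam) is replaced by 1 / (1 + lam), the exponent is tau lam (lam - eps) / (1 + lam).
   The value eps / 2 minimises the numerator and gives - tau eps^2 / (4 + 2 eps), at most - tau
   eps^2 / 5. *)
pose lam := eps / 2.
apply: le_trans (@chernoff x (fun i => lam * (tau - (i == l)%:R)) _ x0 _) _.
  move=> s ltau.
  have [_ y1] := empirical_dist s k0.
  under eq_bigr do rewrite mulrCA mulrBr.
  rewrite -mulr_sumr sumrB sum_mul_indic -mulr_suml y1 mul1r.
  by rewrite mulr_ge0 ?subr_ge0 1?ltW // /lam; lra.
apply: lerXn2r; rewrite ?nnegrE ?expR_ge0 //.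
  by apply: sumr_ge0 => i _; rewrite mulr_ge0 ?expR_ge0.
have Ef i : x 0 i * expR (lam * (tau - (i == l)%:R)) =
   expR (lam * tau) * (x 0 i - (1 - expR (- lam)) * (x 0 i * (i == l)%:R)).
  rewrite mulrBr expRD; case: eqP => _ /=.
    by rewrite !mulr1; ring.
  by rewrite !mulr0 oppr0 expR0; ring.
rewrite (eq_bigr _ (fun i _ => Ef i)) -mulr_sumr sumrB -mulr_sumr.
rewrite sum_mul_indic x1 xl.
(* Uses 1 - u <= exp (- u) to merge both factors into one exponential. *)
apply: (@le_trans _ _ (expR (lam * tau) *
          expR (- ((1 - expR (- lam)) * (tau * (1 + eps)))))).
  by rewrite ler_wpM2l ?expR_ge0 ?expR_ge1Dx.
rewrite -expRD ler_expR.
have lam0 : 0 < 1 + lam by rewrite /lam; lra.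
have elam : expR (- lam) <= (1 + lam)^-1.
  by rewrite expRN lef_pV2 ?posrE ?expR_gt0 ?expR_ge1Dx.
have lamE : (1 + lam) * (1 + lam)^-1 = 1 by rewrite divff ?gt_eqF.
set v := (1 + lam)^-1 in elam lamE.
apply: (@le_trans _ _ (tau * (lam - (1 - v) * (1 + eps)))).
  have -> : lam * tau - (1 - expR (- lam)) * (tau * (1 + eps)) =
    tau * (lam - (1 - expR (- lam)) * (1 + eps)) by ring.
  by apply: ler_wpM2l; [exact: ltW | rewrite lerD2l lerN2 ler_wpM2r //; lra].
have -> : - (tau * eps ^+ 2 / 5) = tau * - (eps ^+ 2 / 5) by ring.
apply: ler_wpM2l; first exact: ltW.
rewrite -(ler_pM2l lam0).
have -> : (1 + lam) * (lam - (1 - v) * (1 + eps)) =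
  (1 + lam) * lam - ((1 + lam) - (1 + lam) * v) * (1 + eps) by ring.
rewrite lamE /lam.
nra.
Qed.

Lemma empirical_le_tail x (i j : 'I_n) : is_dist x -> i != j ->
  7 / 16 <= x 0 i -> x 0 j <= 3 / 16 ->
  sample_pr x (fun s => empirical R s 0 i <= empirical R s 0 j)
    <= expR (- 32^-1) ^+ k.
Proof.
move=> [x0 x1] ij xi xj.
apply: le_trans
  (@chernoff x (fun h => ln 2 * ((h == j)%:R - (h == i)%:R)) _ x0 _) _.
  move=> s yij.
  under eq_bigr do rewrite mulrCA mulrBr.
  rewrite -mulr_sumr sumrB !sum_mul_indic.
  by rewrite mulr_ge0 ?subr_ge0 ?ln_ge0 ?ler1n.
apply: lerXn2r; rewrite ?nnegrE ?expR_ge0 //.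
  by apply: sumr_ge0 => h _; rewrite mulr_ge0 ?expR_ge0.
(* With parameter ln 2 the weights are 2 at [j], 1/2 at [i] and 1 elsewhere, so the mean is 1 + x_j
   - x_i / 2 <= 1 + 3/16 - 7/32 = 1 - 1/32. *)
have Ef h : x 0 h * expR (ln 2 * ((h == j)%:R - (h == i)%:R)) =
   x 0 h + x 0 h * (h == j)%:R - 2^-1 * (x 0 h * (h == i)%:R).
  have [->|hj] := eqVneq h j.
    rewrite eq_sym (negbTE ij) subr0 mulr1 lnK ?posrE ?ltr0n //=; ring.
  have [->|hi] := eqVneq h i; last by rewrite /= subr0 mulr0 expR0; ring.
  by rewrite /= sub0r mulrN1 expRN lnK ?posrE ?ltr0n //; field.
rewrite (eq_bigr _ (fun h _ => Ef h)) sumrB big_split -mulr_sumr /=.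
rewrite !sum_mul_indic x1; apply: le_trans (expR_ge1Dx _); lra.
Qed.

End Sampling.

(** * The number of samples *)

Lemma failure_bound (R : realType) (n k : nat) (eps tau : R) :
  (4 <= n)%N -> 0 < eps -> eps <= 1 / 8 -> tau = 1 / (2 * (n%:R - 1)) ->
  20 * (ln n%:R + ln (1 / eps)) * (n%:R / eps ^+ 2) <= k%:R ->
  n%:R * (expR (- (tau * eps ^+ 2 / 5)) ^+ k + expR (- 32^-1) ^+ k) <= eps.
Proof.
move=> n4 eps0 eps8 tauE kge.
have n4R : 4 <= n%:R :> R by rewrite (ler_nat _ 4).
have n0 : 0 < n%:R :> R by lra.
have eps20 : 0 < eps ^+ 2 by rewrite exprn_gt0.
have eps2 : eps ^+ 2 <= 1 / 64 by nra.
(* A common lower bound for both decay rates, as tau >= 1 / (2 n). The constant 20 = 2 * 10 makes k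
   c >= 2 ln (n / eps), so each tail is at most (eps / n)^2. *)
pose c : R := eps ^+ 2 / (10 * n%:R).
have kc : 2 * (ln n%:R + ln (1 / eps)) <= k%:R * c.
  have -> : 2 * (ln n%:R + ln (1 / eps)) =
      20 * (ln n%:R + ln (1 / eps)) * (n%:R / eps ^+ 2) * c.
    by rewrite /c; field; rewrite !gt_eqF.
  by apply: ler_wpM2r => //; rewrite /c ltW // divr_gt0 //; lra.
have term (r : R) : c <= r -> expR (- r) ^+ k <= (eps / n%:R) ^+ 2.
  move=> cr.
  have -> : (eps / n%:R) ^+ 2 = expR (- (2 * (ln n%:R + ln (1 / eps)))).
    rewrite -lnM ?posrE ?divr_gt0 // -mulrN expRM_natl expRN lnK.
      by congr (_ ^+ 2); field; rewrite !gt_eqF.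
    by rewrite posrE mulr_gt0 ?divr_gt0.
  rewrite -expRM_natl ler_expR mulrN lerN2 (le_trans kc) //.
  by apply: ler_wpM2l.
have t1 : c <= tau * eps ^+ 2 / 5.
  have -> : c = (2 * n%:R)^-1 * eps ^+ 2 / 5.
    by rewrite /c; field; rewrite gt_eqF.
  do 2![apply: ler_wpM2r; first lra].
  rewrite tauE div1r lef_pV2 ?posrE; lra.
have t2 : c <= 32^-1.
  by rewrite /c ler_pdivrMr; lra.
apply: (@le_trans _ _ (n%:R * ((eps / n%:R) ^+ 2 + (eps / n%:R) ^+ 2))).
  by apply: ler_wpM2l; [exact: ltW | apply: lerD; apply: term].
have -> : n%:R * ((eps / n%:R) ^+ 2 + (eps / n%:R) ^+ 2) = 2 * eps ^+ 2 / n%:R.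
  by field; rewrite gt_eqF.
rewrite ler_pdivrMr //; nra.
Qed.

(** * The reward bound *)

Theorem proposition2 (R : realType) :
  exists C : R, 0 < C /\
  forall (n : nat) (eps : R), (4 <= n)%N -> 0 < eps -> eps <= 1 / 8 ->
  forall a : 'rV[R]_n -> faction n,
  response_rule (1 / (2 * (n%:R - 1))) a ->
  forall k : nat,
  C * (ln n%:R + ln (1 / eps)) * (n%:R / eps ^+ 2) <= k%:R ->
  1 / 2 - eps <= IR a k (x_eps n eps).
Proof.
exists 20; split=> // n eps n4 eps0 eps8 a.
set tau := 1 / _ => ruleP k kge.
have n4R : 4 <= n%:R :> R by rewrite (ler_nat _ 4).
have tau0 : 0 < tau by rewrite divr_gt0 //; lra.
have xdist : is_dist (x_eps n eps).
  by apply: x_eps_dist; [exact: leq_trans n4 | exact: ltW | lra].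
have fail := failure_bound n4 eps0 eps8 erefl kge.
(* With no samples [empirical] is the zero vector, not a distribution; positivity of ln n excludes
   this. *)
have k0 : (0 < k)%N.
  rewrite -(ltr0n R); apply: lt_le_trans kge.
  have ln1 : 0 < ln n%:R :> R by apply: ln_gt0; lra.
  have ln2 : 0 <= ln (1 / eps) :> R.
    by apply: ln_ge0; rewrite ler_pdivlMr //; lra.
  apply: mulr_gt0; first by rewrite mulr_gt0 // ltr_wpDr.
  by rewrite divr_gt0 ?exprn_gt0 //; lra.
pose i0 : 'I_n := Ordinal (leq_trans (isT : (0 < 4)%N) n4).
set x := x_eps n eps in xdist *.
have xi0 : x 0 i0 = 1 / 2 - eps / 2 by rewrite mxE.
have xl l : l != i0 -> x 0 l = tau * (1 + eps).
  rewrite -(inj_eq val_inj) mxE /= => /negbTE ->.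
  by rewrite /tau; field; rewrite gt_eqF //; lra.
(* Yields x_l <= (1/6) (9/8) = 3/16, the threshold of [empirical_le_tail]; likewise x_1 >= 1/2 -
   1/16 = 7/16. *)
have tau6 : tau <= 6^-1 by rewrite /tau div1r lef_pV2 ?posrE; lra.
pose bad l (s : {ffun 'I_k -> 'I_n}) :=
  (l != i0) && ((empirical R s 0 l < tau)
                || (empirical R s 0 i0 <= empirical R s 0 l)).
have bad_le : sample_pr x (fun s => [exists l, bad l s]) <= eps.
  apply: le_trans (sample_pr_exists _ (proj1 xdist)) _.
  apply: le_trans fail.
  rewrite -[X in X%:R * _](card_ord n) mulr_natl -sumr_const.
  apply: ler_sum => l _.
  (* At [i0] the event is empty; counting it anyway gives the factor n in [fail]. *)
  have [->|li0] := eqVneq l i0.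
    rewrite /sample_pr /bad eqxx big_pred0 //.
    by rewrite addr_ge0 ?exprn_ge0 ?expR_ge0.
  rewrite /bad li0 /=; apply: le_trans (sample_pr_or _ _ (proj1 xdist)) _.
  apply: lerD; first by apply: empirical_lower_tail => //; exact: xl.
  apply: empirical_le_tail => //; first by rewrite eq_sym.
    by rewrite xi0; lra.
  by rewrite xl //; nra.
have reward : (1 - eps) * x 0 i0 <= IR a k x.
  apply: (@le_trans _ _
    (sample_pr x (predC (fun s => [exists l, bad l s])) * x 0 i0)).
    rewrite sample_pr_predC ?(proj2 xdist) //.
    by apply: ler_wpM2r; [exact: (proj1 xdist) | lra].
  rewrite /sample_pr mulr_suml big_mkcond /=; apply: ler_sum => s _.
  have F0 : 0 <= \prod_(t < k) x 0 (s t).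
    by apply: prodr_ge0 => t _; apply: (proj1 xdist).
  case: ifP => [|_]; last first.
    by rewrite mulr_ge0 ?dot_uL_ge0 // => i; apply: (proj1 xdist).
  rewrite negb_exists => /forallP good.
  have goodP l : l != i0 -> (tau <= empirical R s 0 l) /\
      (empirical R s 0 l < empirical R s 0 i0).
    move=> li0; move: (good l).
    by rewrite /bad li0 negb_or -leNgt -ltNge => /andP.
  rewrite (@response_inl _ _ _ _ _ i0 ruleP (empirical_dist R s k0)) //=.
  - by rewrite dot_deltal.
  - by move=> l /goodP[].
  - by move=> l /goodP[].
apply: le_trans reward; rewrite xi0; nra.
Qed.
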